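(* Connected gnomons (of a primitive Pythagorean triple) are uniquely described by the corresponding arithmetic progressions.
   Context: A primitive Pythagorean triple is a triple $(x,y,a)$ of positive integers with $x^2+y^2=a^2$ and $\gcd(x,y,a)=1$; by convention $x$ is the odd leg and $y$ the even leg. A gnomon is an L-shaped figure whose addition to a square produces a larger square; its thickness is the difference between the sides of the larger and the smaller square. A gnomon of thickness $1$ placed on a square of side $n$ has area $(n+1)^2-n^2=2n+1$, and a gnomon of thickness $k$ is composed of $k$ consecutive gnomons of thickness $1$. For a primitive Pythagorean triple $(x,y,a)$, $G_y$ denotes the gnomon placed on the square of side $x$ and completing it to the square of side $a$ (so its area is $y^2$), and $G_x$ denotes the gnomon placed on the square of side $y$ and completing it to the square of side $a$ (so its area is $x^2$). The two gnomons $G_x$ and $G_y$, represented together with their common outer side $a$ so that the larger absorbs the smaller, are called connected gnomons. The arithmetic progression corresponding to a gnomon is the sequence of areas of the consecutive gnomons of thickness $1$ composing it, starting from the innermost one; an arithmetic progression is given by its first term, its common difference and its number of terms. *)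

(* Defs.v *)
From mathcomp Require Import all_boot finmap.

Set Implicit Arguments.
Unset Strict Implicit.
Unset Printing Implicit Defensive.

(* The convention that x is the odd leg and y the even leg is included. *)
Definition primitive_pythagorean_triple (x y a : nat) : Prop :=
  [/\ [&& 0 < x, 0 < y & 0 < a], x ^ 2 + y ^ 2 = a ^ 2,
      gcdn (gcdn x y) a = 1, odd x & ~~ odd y].

(* All sides being integers, a plane figure is the finite set of the unit
   cells [i, i+1] x [j, j+1] composing it, and its area is their number. *)
Definition figure := {fset nat * nat}.

Definition area (F : figure) : nat := #|` F|.

Definition square (n : nat) : figure :=
  [fset p in [seq (i, j) | i <- iota 0 n, j <- iota 0 n]]%fset.

(* All squares share the corner at the origin; thickness is m - n. *)
Definition gnomon (n m : nat) : figure := (square m `\` square n)%fset.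

(* The pair (G_x, G_y): both gnomons lie in the same square of side a, along
   the same outer sides, so the larger one contains the smaller one. *)
Definition connected_gnomons (G : figure * figure) : Prop :=
  exists x y a : nat,
    primitive_pythagorean_triple x y a /\ G = (gnomon y a, gnomon x a).

Record progression := Progression {
  first_term : nat;
  common_difference : nat;
  number_of_terms : nat
}.

Definition terms (P : progression) : seq nat :=
  mkseq (fun i => first_term P + i * common_difference P) (number_of_terms P).

(* Innermost first. *)
Definition unit_gnomons (n m : nat) : seq figure :=
  [seq gnomon k k.+1 | k <- iota n (m - n)].

(* A gnomon of thickness 1, such as G_y or G_x may be, has a single area in
   its progression, which leaves the common difference undetermined; it is
   then fixed to 2, the value forced by the areas in every other case. *)
Definition corresponding_progression (F : figure) (P : progression) : Prop :=
  exists n m : nat,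
    [/\ n < m, F = gnomon n m,
        terms P = [seq area g | g <- unit_gnomons n m]
      & common_difference P = 2].

Definition described_by (G : figure * figure) (P : progression * progression) :
    Prop :=
  corresponding_progression G.1 P.1 /\ corresponding_progression G.2 P.2.

(* Main.v *)
Require Import Defs.
From mathcomp Require Import all_boot finmap.

(** The areas of the unit gnomons composing the gnomon from side [n] to side [m]
    are the odd numbers [2n+1, 2n+3, ..., 2m-1]. The first term therefore gives
    back [n] and the number of terms gives back [m - n], while [n] and [m] are
    read off the figure as the bounds of its bottom row. *)

Local Open Scope fset_scope.

Lemma mem_square n i j : ((i, j) \in square n) = (i < n) && (j < n).
Proof.
rewrite /square inE /=; apply/allpairsP/andP => [[[k l] /=]|[lt_in lt_jn]].
  by rewrite !mem_iota !add0n => -[lt_kn lt_ln [-> ->]].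
by exists (i, j); split; rewrite ?mem_iota.
Qed.

Lemma area_square n : area (square n) = n ^ 2.
Proof.
rewrite /area /square card_fseq undup_id.
  by rewrite size_allpairs size_iota mulnn.
by apply: allpairs_uniq => [||[i j] [k l] _ _ [-> ->]]; rewrite ?iota_uniq.
Qed.

Lemma square_sub n m : n <= m -> square n `<=` square m.
Proof.
move=> le_nm; apply/fsubsetP => -[i j]; rewrite !mem_square.
by case/andP=> lt_in lt_jn; rewrite !(leq_trans _ le_nm).
Qed.

Lemma area_gnomon n m : n <= m -> area (gnomon n m) = m ^ 2 - n ^ 2.
Proof.
move=> le_nm.
by rewrite -!area_square /area /gnomon cardfsDS ?square_sub.
Qed.

Lemma mem_gnomon_bottom n m i :
  n < m -> ((i, 0) \in gnomon n m) = (n <= i < m).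
Proof.
move=> lt_nm; rewrite in_fsetD !mem_square (leq_ltn_trans (leq0n n) lt_nm) andbT.
(* For [n = 0] nothing is removed; otherwise row [0] does meet the removed square, which takes away
   exactly the cells with [i < n]. *)
case: n lt_nm => [|n] _; first by rewrite ltn0.
by rewrite andbT -leqNgt.
Qed.

(** Equal figures have equal bottom rows, and nonempty integer intervals with the same points have
    the same bounds: test membership at [n], [n'], [m] and [m']. *)
Lemma gnomon_inj n m n' m' :
  n < m -> n' < m' -> gnomon n m = gnomon n' m' -> (n, m) = (n', m').
Proof.
move=> lt_nm lt_nm' eqG.
have eqI i : (n <= i < m) = (n' <= i < m').
  by rewrite -!mem_gnomon_bottom // eqG.
have := eqI n; rewrite leqnn lt_nm => /esym /andP[le_n'n _].
have := eqI n'; rewrite leqnn lt_nm' => /andP[le_nn' _].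
have eqn : n = n' by apply/eqP; rewrite eqn_leq le_nn'.
have := eqI m; rewrite ltnn andbF -eqn (ltnW lt_nm) => /esym /negbT.
rewrite -leqNgt => le_m'm.
have := eqI m'; rewrite ltnn andbF (ltnW (leq_ltn_trans le_nn' lt_nm')).
move=> /negbT; rewrite -leqNgt => le_mm'.
by congr (_, _) => //; apply/eqP; rewrite eqn_leq le_mm'.
Qed.

Definition gnomon_progression (n m : nat) : progression :=
  Progression n.*2.+1 2 (m - n).

Lemma area_unit_gnomons n m :
  [seq area g | g <- unit_gnomons n m] = terms (gnomon_progression n m).
Proof.
(* Reindexing by [k = n + i] reduces the claim to [(n + i + 1) ^ 2 - (n + i) ^ 2 = (2n + 1) +
   2i]. *)
rewrite /terms /mkseq /unit_gnomons /= -[n in iota n]addn0 iotaDl -!map_comp.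
apply: eq_map => i /=.
rewrite area_gnomon // -[(n + i).+1]addn1 sqrnD -addnA addKn muln1 exp1n.
by rewrite muln2 addnC mul2n doubleD addn1 addSn.
Qed.

(** The size of the list is the number of terms and its head is the first term. The differences are
    assumed equal because a one-term list does not determine them. *)
Lemma terms_inj P Q :
  0 < number_of_terms P -> common_difference P = common_difference Q ->
  terms P = terms Q -> P = Q.
Proof.
case: P Q => [a d k] [b e l] /= k_gt0 <- eqt.
have eqk : k = l by have := congr1 size eqt; rewrite !size_mkseq.
have := congr1 (nth 0 ^~ 0) eqt.
by rewrite -eqk !nth_mkseq //= !addn0 => ->.
Qed.

(** By [gnomon_inj] the sides hidden in the existential must be [n] and [m], so the correspondence
    is the graph of a function. *)
Lemma corresponding_progressionP n m P :
  n < m ->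
  corresponding_progression (gnomon n m) P <-> P = gnomon_progression n m.
Proof.
move=> lt_nm; split=> [[n' [m' [lt_nm' eqG eqt eqd]]]|->]; last first.
  by exists n, m; split=> //; rewrite area_unit_gnomons.
have [-> ->] := gnomon_inj _ _ _ _ lt_nm lt_nm' eqG.
rewrite area_unit_gnomons in eqt.
by apply/esym/terms_inj => //=; rewrite subn_gt0.
Qed.

Lemma gnomon_progression_inj n m n' m' :
  n < m -> n' < m' ->
  gnomon_progression n m = gnomon_progression n' m' -> (n, m) = (n', m').
Proof.
move=> lt_nm lt_nm' eqP.
have /succn_inj/double_inj eqn := congr1 first_term eqP.
have /= eqk := congr1 number_of_terms eqP; rewrite -eqn in lt_nm' eqk *.
by rewrite -(subnKC (ltnW lt_nm)) eqk subnKC // ltnW.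
Qed.

(** Each leg has a square smaller than [a ^ 2] by the positive square of the other; hence both
    gnomons of a triple are nonempty. *)
Lemma pythagorean_legs_lt x y a :
  primitive_pythagorean_triple x y a -> y < a /\ x < a.
Proof.
case=> /and3P[x_gt0 y_gt0 _] eqa _ _ _.
by split; rewrite -ltn_sqr -eqa -subn_gt0 ?addnK ?addKn expn_gt0 ?x_gt0 ?y_gt0.
Qed.

Theorem theorem2p1 :
  (forall G : figure * figure, connected_gnomons G ->
     exists! P : progression * progression, described_by G P)
  /\
  (forall (G G' : figure * figure) (P : progression * progression),
     connected_gnomons G -> connected_gnomons G' ->
     described_by G P -> described_by G' P -> G = G').
Proof.
split=> [G [x [y [a [/pythagorean_legs_lt[lt_ya lt_xa] ->]]]]|].
  exists (gnomon_progression y a, gnomon_progression x a); split.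
    by split; apply/corresponding_progressionP.
  by case=> P Q [/= /corresponding_progressionP-> // /corresponding_progressionP->].
move=> G G' [P Q] [x [y [a [/pythagorean_legs_lt[lt_ya lt_xa] ->]]]].
move=> [x' [y' [a' [/pythagorean_legs_lt[lt_ya' lt_xa'] ->]]]].
case=> /= /corresponding_progressionP-> // /corresponding_progressionP-> //.
case=> /= /corresponding_progressionP eqy /corresponding_progressionP eqx.
(* The progression of [G_y] recovers [y] and the common outer side [a]; that of [G_x] has only [x]
   left to supply. *)
have [-> ->] := gnomon_progression_inj _ _ _ _ lt_ya lt_ya' (eqy lt_ya').
by have [-> _] := gnomon_progression_inj _ _ _ _ lt_xa lt_xa' (eqx lt_xa').
Qed.
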